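(* For all real $y\ge2$ and all $n\ge1$, $|P_n(y)|\le 3\cdot n!\,y^n$; moreover $|P_0(y)|\le y$ for $y\ge2$.
   Context: The polynomials $P_n(y)$ are defined by $P_0(y)=y-1$ and, for $n\ge1$, $P_n=nP_{n-1}-P'_{n-1}+\frac{1}{n}\sum_{k=1}^{n-1}k\{(k-1)P_{k-1}-P_k-P'_{k-1}\}P_{n-k-1}$, primes denoting derivatives in $y$ (equivalently, $1+\sum_{n\ge1}P_{n-1}(y)x^{-n}$ is the unique formal solution of $V=1+\frac{y}{x}-\frac{1}{x}V-V_x-\frac{1}{x}V_y+\frac{1}{x}\log V$). *)

(* Defs.v *)
From mathcomp Require Import all_boot all_order all_algebra.
From mathcomp Require Import reals.
Set Implicit Arguments. Unset Strict Implicit. Unset Printing Implicit Defensive.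
Import GRing.Theory Num.Theory.
Local Open Scope ring_scope.

Section Pdef.
Variable F : fieldType.

(* Given s = [:: P_0; ...; P_(m-1)], compute P_m (for m >= 1):
   P_m = m P_(m-1) - P'_(m-1)
         + (1/m) \sum_(k=1)^(m-1) k ((k-1) P_(k-1) - P_k - P'_(k-1)) P_(m-k-1). *)
Definition Pnext (m : nat) (s : seq {poly F}) : {poly F} :=
  m%:R *: s`_(m.-1) - (s`_(m.-1))^`()
  + (m%:R)^-1 *: \sum_(1 <= k < m)
       (k%:R *: ((k.-1)%:R *: s`_(k.-1) - s`_k - (s`_(k.-1))^`()) * s`_(m - k - 1)).

Fixpoint Pseq (n : nat) : seq {poly F} :=
  match n with
  | 0 => [:: 'X - 1]
  | n'.+1 => let s := Pseq n' in rcons s (Pnext n'.+1 s)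
  end.

Definition P (n : nat) : {poly F} := nth 0 (Pseq n) n.
End Pdef.

(* Main.v *)
(** The series [V = 1 + sum_(n >= 1) P_(n-1) x^-n] also satisfies the linear
    equation [(x - 1) V_y = V + x V_x], that is
    [P_(n+1)' = P_n' - n P_n].  Put [Q_n := P_n + P_n'], which for [n >= 1] is
    the coefficient of [x^-n] in [log V]; then
    [n Q_n = n P_(n-1) - sum_(1 <= k < n) k Q_k P_(n-1-k)].
    The linear equation is proved by induction together with this identity and
    the coefficients of [V_y = V (log V)_y].  For [y >= 2] the two relations
    propagate the bounds [|P_n'| <= n! y^n / 2], [|Q_n| <= (n-1)! y^n] and hence
    [|P_n| <= |Q_n| + |P_n'| <= n! y^n], which is stronger than the claim. *)

Require Import Defs.
From mathcomp Require Import all_boot all_order all_algebra.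
From mathcomp Require Import reals.
From mathcomp Require Import ring lra.
Import Order.TTheory GRing.Theory Num.Theory.
Local Open Scope ring_scope.

(** * The recurrence in explicit form *)

Section Recurrence.
Variable F : fieldType.

Lemma size_Pseq n : size (Pseq F n) = n.+1.
Proof. by elim: n => //= n IH; rewrite size_rcons IH. Qed.

Lemma nth_Pseq n k : (k <= n)%N -> (Pseq F n)`_k = P F k.
Proof.
elim: n => [|n IH] /=; first by case: k.
rewrite nth_rcons size_Pseq ltnS leq_eqVlt => /orP[/eqP->|lkn].
  by rewrite ltnn eqxx /P /= nth_rcons size_Pseq ltnn eqxx.
by rewrite -ltnS lkn IH.
Qed.

Lemma P_rec n :
  P F n.+1 = n.+1%:R * P F n - (P F n)^`() + n.+1%:R^-1 *:
    \sum_(k < n) k.+1%:R *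
      (k%:R * P F k - P F k.+1 - (P F k)^`()) * P F (n - k.+1).
Proof.
rewrite {1}/P [Pseq _ n.+1]/= nth_rcons size_Pseq ltnn eqxx /Pnext nth_Pseq //.
rewrite scaler_nat mulr_natl; congr (_ + _ *: _).
rewrite big_add1 /= big_mkord; apply: eq_bigr => k _.
rewrite !scaler_nat !mulr_natl subn1 subSS -subnS.
by rewrite !nth_Pseq ?leq_subr // ltnW.
Qed.

End Recurrence.

(** Subtracts a known equation from the goal; chained uses leave a linear combination of hypotheses
    that [ring] can check. *)
Lemma eq_subeq {V : zmodType} {a b x y : V} : a = b -> x - a = y - b -> x = y.
Proof. by move=> -> /addIr. Qed.

(** * The linear differential relation and the logarithmic identities *)

Section DerivativeRelation.
Variable F : numFieldType.
Implicit Types n m k : nat.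

Local Notation p := (P F).
Local Notation dp n := (P F n)^`().

(* [Q n] is the coefficient of [x^-n] in [y + log V]. *)
Definition Q n : {poly F} := p n + dp n.

Lemma P0E : p 0 = 'X - 1. Proof. by []. Qed.

Lemma deriv_P0 : dp 0 = 1.
Proof. by rewrite P0E derivXsubC. Qed.

Lemma P1E : p 1 = 'X - 2%:R.
Proof. by rewrite P_rec big_ord0 scaler0 addr0 deriv_P0 P0E; ring. Qed.

Lemma deriv_P1 : dp 1 = 1.
Proof. by rewrite P1E -polyC_natr derivXsubC. Qed.

Lemma deriv_Q0 : (Q 0)^`() = 1.
Proof. by rewrite /Q deriv_P0 derivD deriv_P0 derivC addr0. Qed.

Lemma deriv_Q1 : (Q 1)^`() = 1.
Proof. by rewrite /Q deriv_P1 derivD deriv_P1 derivC addr0. Qed.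

Lemma natpoly_neq0 n : n.+1%:R != 0 :> {poly F}.
Proof. by rewrite -polyC_natr polyC_eq0 pnatr_eq0. Qed.

Lemma deriv_natM n (q : {poly F}) : (n%:R * q)^`() = n%:R * q^`().
Proof. by rewrite !mulr_natl derivMn. Qed.

(* Coefficients of [x^-(n+1)] in [x V_x = V * x (log V)_x],
   in [V + V_y = V (y + log V)_y], and of [x^-n] in [(x - 1) V_y = V + x V_x]. *)
Definition log_x n :=
  n.+1%:R * Q n.+1 = n.+1%:R * p n - \sum_(k < n.+1) k%:R * Q k * p (n - k).
Definition log_y n :=
  (Q n.+1)^`() = Q n - \sum_(k < n.+1) (Q k)^`() * p (n - k).
Definition deriv_rel n := dp n.+1 = dp n - n%:R * p n.

Lemma deriv_rel_Q n : deriv_rel n -> (Q n.+1)^`() = (Q n)^`() - n%:R * Q n.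
Proof.
by rewrite /deriv_rel /Q !derivD => ->; rewrite derivB deriv_natM; ring.
Qed.

(** By [deriv_rel k], the bracket of the recurrence is [- Q k.+1]. Once [deriv_rel n] is known, this
    becomes [log_x n]. *)
Lemma P_rec_Q n : (forall k, (k < n)%N -> deriv_rel k) ->
  n.+1%:R * (p n.+1 + (dp n - n%:R * p n)) =
  n.+1%:R * p n - \sum_(k < n.+1) k%:R * Q k * p (n - k).
Proof.
move=> IH; rewrite big_ord_recl /= !mul0r add0r {1}P_rec.
set s1 := \sum_(k < n) _; set s2 := \sum_(k < n) _.
have -> : s1 = - s2.
  rewrite /s1 /s2 -sumrN; apply: eq_bigr => k _.
  by rewrite /Q /bump /= add1n (IH k (ltn_ord k)); ring.
have e : n.+1%:R * (n.+1%:R^-1 *: - s2) = - s2 :> {poly F}.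
  by rewrite mulr_natl -scaler_nat scalerA mulfV ?scale1r // pnatr_eq0.
by rewrite !mulrDr e; ring.
Qed.

Lemma deriv_log_sum n m (a b : nat -> {poly F}) :
  (\sum_(k < n) k%:R * a k * b (m - k)%N)^`() =
  \sum_(k < n) k%:R * (a k)^`() * b (m - k)%N +
  \sum_(k < n) k%:R * a k * (b (m - k)%N)^`().
Proof.
rewrite raddf_sum -big_split /=; apply: eq_bigr => k _.
by rewrite derivM deriv_natM.
Qed.

(** Shifting the index by [deriv_rel] brings the sums of order [n.+1] back to convolutions of order
    [n], which [ring] then treats as atoms. *)
Lemma deriv_rel_sums n : (forall k, (k <= n)%N -> deriv_rel k) ->
  let s (a : nat -> {poly F}) (b : nat -> {poly F}) :=
    \sum_(k < n.+1) a k * b (n - k)%N in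
  [/\ \sum_(k < n.+2) (Q k)^`() * p (n.+1 - k) =
      p n.+1 + s (fun k => (Q k)^`()) p - s (fun k => k%:R * Q k) p
    & \sum_(k < n.+2) k%:R * (Q k)^`() * p (n.+1 - k) +
      \sum_(k < n.+2) k%:R * Q k * dp (n.+1 - k) =
      s (fun k => k%:R * (Q k)^`()) p + s (fun k => k%:R * Q k) (fun k => dp k)
      + s (fun k => (Q k)^`()) p - n.+1%:R * s (fun k => k%:R * Q k) p
      + n.+1%:R * Q n.+1].
Proof.
move=> IH s; split.
  rewrite big_ord_recl /= deriv_Q0 mul1r subn0 -addrA; congr (_ + _).
  rewrite /s -sumrB; apply: eq_bigr => k _.
  rewrite /bump /= add1n subSS deriv_rel_Q; last by apply: IH; rewrite -ltnS.
  by ring.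
rewrite big_ord_recl /= !mul0r add0r [X in _ + X]big_ord_recr /= subnn.
rewrite deriv_P0 mulr1 [LHS]addrA.
congr (_ + _); rewrite /s mulr_sumr -!big_split -sumrB /=.
apply: eq_bigr => k _; have lkn : (k <= n)%N by rewrite -ltnS.
rewrite /bump /= add1n subSS (deriv_rel_Q _ (IH k lkn)) subSn //.
by rewrite (IH _ (leq_subr k n)) natrB //; ring.
Qed.

Lemma log_relations n : [/\ log_x n, log_y n & deriv_rel n].
Proof.
elim/ltn_ind: n => n IH.
have IHd k : (k < n)%N -> deriv_rel k by case/IH.
have H := P_rec_Q _ IHd.
case: n => [|n] in IH IHd H *.
  split; rewrite /log_x /log_y /deriv_rel ?big_ord1 ?subn0 /=.
  - by rewrite /Q deriv_P1 P1E P0E; ring.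
  - by rewrite deriv_Q1 deriv_Q0 /Q deriv_P0; ring.
  - by rewrite deriv_P1 deriv_P0; ring.
have [lx ly _] := IH n (ltnSn n).
have dreln := IHd n (ltnSn n).
have [sy sx] := deriv_rel_sums _ IHd.
have drel : deriv_rel n.+1.
  have := congr1 (fun q : {poly F} => q^`()) H.
  rewrite deriv_natM derivB deriv_log_sum deriv_natM sx derivD.
  have := congr1 (fun q : {poly F} => q^`()) lx.
  rewrite derivB deriv_log_sum !deriv_natM => dlx.
  rewrite derivB deriv_natM => dH.
  (* After scaling by [n.+2], the goal is the derivative of [H], minus that of [log_x n], plus
     [n.+1] times [log_x n], minus [log_y n], plus [n.+2] times [deriv_rel n]. *)
  apply: (mulfI (natpoly_neq0 n.+1)).
  apply: (eq_subeq dH); apply: (eq_subeq (esym dlx)).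
  apply: (eq_subeq (congr1 ( *%R n.+1%:R) lx)); apply: (eq_subeq (esym ly)).
  apply: (eq_subeq (congr1 ( *%R n.+2%:R) dreln)).
  by rewrite /Q !derivD; ring.
split=> //.
- by rewrite /log_x -H /Q drel.
- rewrite /log_y sy deriv_rel_Q //.
  apply: (eq_subeq ly); apply: (eq_subeq (esym lx)).
  by apply: (eq_subeq (esym dreln)); rewrite /Q; ring.
Qed.

End DerivativeRelation.

Lemma fact_mul_le a b : (a.+1`! * b.+1`! <= (a + b).+1`!)%N.
Proof.
elim: a => [|a IH]; first by rewrite mul1n.
rewrite factS -mulnA addSn [in leqRHS]factS.
by rewrite leq_mul // !ltnS leq_addr.
Qed.

(** * Propagation of the bounds for [y >= 2] *)

Section Bounds.
Variables (R : realFieldType) (y : R).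
Hypothesis hy : 2 <= y.

Local Notation p n := (P R n).[y].
Local Notation dp n := (P R n)^`().[y].
Local Notation q n := (Q R n).[y].
Local Notation w n := (n`!%:R * y ^+ n).

Let y_ge0 : 0 <= y. Proof. exact: le_trans hy. Qed.

Lemma norm_P0_le : `|p 0| <= y.
Proof. by rewrite P0E !hornerE ler_norml; move: hy; lra. Qed.

Lemma horner_natM n (r : {poly R}) : (n%:R * r).[y] = n%:R * r.[y].
Proof. by rewrite hornerM -polyC_natr hornerC. Qed.

(** The relation gives at most [(2m + 3) w m.+1], and [2m + 3 <= (m + 2) y]. *)
Lemma dP_le m : `|p m.+1| <= w m.+1 -> 2 * `|dp m.+1| <= w m.+1 ->
  2 * `|dp m.+2| <= w m.+2.
Proof.
have [_ _ ->] := log_relations R m.+1.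
rewrite hornerD hornerN horner_natM => hp hd.
have h1 : `|dp m.+1 - m.+1%:R * p m.+1| <= `|dp m.+1| + m.+1%:R * `|p m.+1|.
  by rewrite (le_trans (ler_normB _ _)) // normrM normr_nat.
have h2 : m.+1%:R * `|p m.+1| <= m.+1%:R * w m.+1 by rewrite ler_wpM2l.
have -> : w m.+2 = (m%:R + 2) * (w m.+1) * y.
  by rewrite factS natrM exprSr -[m.+2]addn2 natrD; ring.
have w0 : 0 <= w m.+1 by rewrite mulr_ge0 // exprn_ge0.
have h3 : 0 <= (m%:R + 2) * w m.+1 * (y - 2).
  by rewrite !mulr_ge0 ?subr_ge0 ?exprn_ge0 ?addr_ge0 //.
move: h1 h2 h3 hd; rewrite -[m.+1%:R]natr1; move: (w m.+1) w0 => W W0.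
by lra.
Qed.

(** The term [k = 0] vanishes. Each of the [m] middle terms is at most [m! y^(m+1)] by
    [fact_mul_le]. The last contains [P_0], bounded only by [y], and is treated apart. *)
Lemma log_sum_le m :
  (forall k, (k <= m)%N -> `|p k.+1| <= w k.+1) ->
  (forall k, (k <= m)%N -> `|q k.+1| <= k`!%:R * y ^+ k.+1) ->
  `|\sum_(k < m.+2) k%:R * q k * p (m.+1 - k)| <=
  (m%:R + m.+1%:R * y) * (m`!%:R * y ^+ m.+1).
Proof.
move=> hp hq; rewrite big_ord_recl /= !mul0r add0r big_ord_recr /=.
rewrite (le_trans (ler_normD _ _)) // mulrDl lerD //; last first.
  rewrite /bump add1n subnn !normrM normr_nat -!mulrA ler_wpM2l //.
  by rewrite [leRHS]mulrC ler_pM // ?hq // norm_P0_le.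
rewrite (le_trans (ler_norm_sum _ _ _)) //.
rewrite mulr_natl -[X in _ *+ X]card_ord -sumr_const ler_sum // => -[j ltjm] _ /=.
rewrite /bump add1n subSS !normrM normr_nat.
have [b def_m] : exists b, m = (j + b).+1.
  by exists (m - j.+1)%N; rewrite -addSn subnKC.
have -> : (m - j = b.+1)%N by rewrite def_m -addnS addKn.
have hb : `|p b.+1| <= w b.+1.
  by apply: hp; rewrite def_m ltnW // ltnS leq_addl.
have hj : j.+1%:R * `|q j.+1| <= w j.+1.
  by rewrite factS natrM -mulrA ler_wpM2l // hq // ltnW.
rewrite (le_trans (ler_pM _ _ hj hb)) ?mulr_ge0 //.
rewrite mulrACA -natrM -exprD addSn addnS -def_m ler_wpM2r ?exprn_ge0 //.
by rewrite ler_nat def_m fact_mul_le.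
Qed.

Lemma Q_le m :
  (forall k, (k <= m)%N -> `|p k.+1| <= w k.+1) ->
  (forall k, (k <= m)%N -> `|q k.+1| <= k`!%:R * y ^+ k.+1) ->
  `|q m.+2| <= m.+1`!%:R * y ^+ m.+2.
Proof.
move=> hp hq; have hS := log_sum_le _ hp hq; have hpm := hp m (leqnn m).
have [lx _ _] := log_relations R m.+1.
have := congr1 (fun r : {poly R} => r.[y]) lx.
rewrite hornerD hornerN !horner_natM horner_sum.
under eq_bigr do rewrite hornerM horner_natM.
set S := \sum_(k < _) _ in hS * => e.
rewrite -(@ler_pM2l _ m.+2%:R) ?ltr0n // -{1}[m.+2%:R]normr_nat -normrM e.
rewrite (le_trans (ler_normB _ _)) // normrM normr_nat.
have h1 : m.+2%:R * `|p m.+1| <= m.+2%:R * w m.+1 by rewrite ler_wpM2l.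
move: h1 hS; rewrite factS natrM [y ^+ m.+2]exprSr.
rewrite -[m.+2]addn2 -[m.+1%:R]natr1 natrD -mulrA.
have : 0 <= m`!%:R * y ^+ m.+1 by rewrite mulr_ge0 // exprn_ge0.
rewrite -!mulrA [m`!%:R * (_ * y)]mulrA; move: (m`!%:R * _) => g g0 h1 hS.
(* The slack in the goal is [g] times [(m+1)^2 (y-2) + m^2]. *)
have h3 : 0 <= (m%:R + 1) ^+ 2 * g * (y - 2).
  by rewrite !mulr_ge0 ?subr_ge0 ?exprn_ge0 ?addr_ge0 //.
have h4 : 0 <= m%:R ^+ 2 * g by rewrite mulr_ge0 // exprn_ge0.
by lra.
Qed.

Lemma P_bounds m : [/\ `|p m.+1| <= w m.+1, 2 * `|dp m.+1| <= w m.+1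
  & `|q m.+1| <= m`!%:R * y ^+ m.+1].
Proof.
elim/ltn_ind: m => -[_|m IH].
  rewrite /Q deriv_P1 P1E -polyC_natr !hornerE normr1 !ler_norml.
  by move: hy; split; lra.
have hq : `|q m.+2| <= m.+1`!%:R * y ^+ m.+2.
  by apply: Q_le => k lekm; case: (IH k).
have hd : 2 * `|dp m.+2| <= w m.+2 by case: (IH m) => // *; apply: dP_le.
split=> //.
(* With [g = (m+1)! y^(m+2)], the two parts are at most [g] and [(m+2) g / 2], whose sum is at most
   [(m+2) g]. *)
have -> : p m.+2 = q m.+2 - dp m.+2 by rewrite /Q hornerD addrK.
rewrite (le_trans (ler_normB _ _)) //.
have h0 : 0 <= m%:R * (m.+1`!%:R * y ^+ m.+2).
  by rewrite mulr_ge0 // mulr_ge0 // exprn_ge0.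
have eW : w m.+2 = (m%:R + 2) * (m.+1`!%:R * y ^+ m.+2).
  by rewrite factS natrM -addn2 natrD mulrA.
by move: hd; rewrite eW; lra.
Qed.

End Bounds.

Theorem theorem5p9 (R : realType) (y : R) (hy : 2 <= y) :
  (forall n : nat, (1 <= n)%N -> `|(P R n).[y]| <= 3 * (n`!)%:R * y ^+ n)
  /\ `|(P R 0).[y]| <= y.
Proof.
split; last exact: norm_P0_le.
case=> // n _; have [hp _ _] := P_bounds _ _ hy n.
rewrite -mulrA (le_trans hp) // ler_peMl ?ler1n //.
by rewrite mulr_ge0 // exprn_ge0 // (le_trans _ hy).
Qed.
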